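(* Let $p$ be an odd prime and $n \in \mathbb{N}$, $n \ge 1$. (i) $\operatorname{ord}_p(M_n) = 0$ if $n$ is not a multiple of $v(p)$. (ii) If $n = v(p)\cdot p^r\cdot k$ with integers $r \ge 0$, $k \ge 1$, and $p$ does not divide $k$, then $\operatorname{ord}_p(n) = r$ and $\operatorname{ord}_p(M_n) = \varepsilon(p) + r$.
   Context: For $n \ge 1$ let $M_n = 2^n - 1$. For a prime $p$, $\operatorname{ord}_p$ denotes the $p$-adic valuation. For an odd prime $p$, the Mersenne order $v(p)$ is the smallest integer $r \ge 1$ such that $p$ divides $M_r$, and the Wieferich exponent is $\varepsilon(p) = \operatorname{ord}_p(M_{v(p)})$. *)

(* Defs.v *)
From mathcomp Require Import all_boot.
From mathcomp Require Import cyclic.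

Set Implicit Arguments.
Unset Strict Implicit.
Unset Printing Implicit Defensive.

(* Truncated subtraction is harmless here: [2 ^ n] is positive. *)
Definition mersenne (n : nat) : nat := 2 ^ n - 1.

Lemma mersenne_order_exists (p : nat) (p_odd : odd p) :
  exists r, (0 < r) && (p %| mersenne r).
Proof.
exists (totient p); rewrite totient_gt0 odd_gt0 //=.
rewrite /mersenne -eqn_mod_dvd ?expn_gt0 //.
by apply/eqP/Euler_exp_totient; rewrite coprime2n.
Qed.

(* The minimum exists for every odd [p], prime or not, by Euler's theorem. *)
Definition mersenne_order (p : nat) (p_odd : odd p) : nat :=
  ex_minn (mersenne_order_exists p_odd).

(* The p-adic valuation is [logn p]: for prime [p] and positive [m],
   [logn p m] is the exponent of [p] in [m]; it would be 0 at [m = 0], but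
   [mersenne r] is positive for [r >= 1]. *)
Definition wieferich_exponent (p : nat) (p_odd : odd p) : nat :=
  logn p (mersenne (mersenne_order p_odd)).

(* Main.v *)
Require Import Defs.
From mathcomp Require Import all_boot.
From mathcomp Require Import cyclic.

Set Implicit Arguments.
Unset Strict Implicit.
Unset Printing Implicit Defensive.

(** The key is the lifting-the-exponent law: if [p] is an odd prime dividing
    [m - 1], then [m ^ n - 1] has [p]-adic valuation that of [m - 1] plus that
    of [n].  It comes from the factorisation
    [m ^ n - 1 = (m - 1) * (1 + m + ... + m ^ (n - 1))].  Since [m = 1] modulo
    [p], the second factor is congruent to [n] modulo [p], so an exponent prime
    to [p] leaves the valuation unchanged ([logn_predX_coprime]).  For [n = p]
    an expansion to first order in [m - 1] shows that this factor is congruent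
    to [p] modulo [p ^ 2], so an exponent [p] raises the valuation by exactly
    one ([logn_predX_prime]).

    Applied to [m = 2 ^ v], where [v] is the Mersenne order of [p], this law
    gives the valuation of the Mersenne numbers whose index is a multiple of
    [v].  At any other index [n], division with remainder by [v] reduces [2 ^ n]
    modulo [p] to a power of 2 with exponent strictly between 0 and [v], and the
    minimality of [v] applies ([dvdn_mersenne]).  Finally [p] does not divide
    [v], because [v < p] by Fermat's little theorem; hence the valuation of
    [v * p ^ r * k] comes from [p ^ r] alone. *)

(** The geometric sum has [n] terms, each congruent to 1. *)
Lemma geometric_sum_mod (p m n : nat) :
  m = 1 %[mod p] -> \sum_(i < n) m ^ i = n %[mod p].
Proof.
move=> m1; rewrite -modn_summ.
under eq_bigr => i _ do rewrite -modnXm m1 modnXm exp1n.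
by rewrite modn_summ sum1_card card_ord.
Qed.

(** All terms of degree at least two in the binomial expansion are multiples of
    [y ^ 2]. *)
Lemma expn_first_order (d y i : nat) :
  d %| y ^ 2 -> y.+1 ^ i = 1 + i * y %[mod d].
Proof.
move=> d_y2; elim: i => [|i IHi]; first by rewrite expn0 mul0n addn0.
rewrite expnS -modnMmr IHi modnMmr.
have ->: y.+1 * (1 + i * y) = i * y ^ 2 + (1 + i.+1 * y).
  by rewrite !mulSn mulnDr muln1 mulnCA mulnn addnA [in LHS]addnC addnAC addnA.
by rewrite -modnDml (eqP (dvdn_mull i d_y2)) add0n.
Qed.

(** To first order in [m - 1] the sum is [p + 'C(p, 2) * (m - 1)].  The
    binomial coefficient is a multiple of [p] because [p] is odd, so the second
    term is a multiple of [p ^ 2]. *)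
Lemma geometric_sum_mod_sqr (p m : nat) :
  prime p -> odd p -> 0 < m -> p %| m.-1 ->
  \sum_(i < p) m ^ i = p %[mod p ^ 2].
Proof.
case: m => // y p_prime p_odd _ /= p_y.
have p2_y2: p ^ 2 %| y ^ 2 by rewrite dvdn_exp2r.
rewrite -modn_summ; under eq_bigr => i _ do rewrite (expn_first_order i p2_y2).
rewrite modn_summ big_split /= sum1_card card_ord -big_distrl /=.
rewrite -(big_mkord xpredT id) bin2_sum.
have p_bin: p %| 'C(p, 2).
  by rewrite prime_dvd_bin //= odd_prime_gt2.
by rewrite -modnDmr (eqP (dvdn_mul p_bin p_y : p ^ 2 %| _)) addn0.
Qed.

Lemma logn_predX_coprime (p m n : nat) :
  prime p -> 1 < m -> p %| m.-1 -> ~~ (p %| n) ->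
  logn p (m ^ n).-1 = logn p m.-1.
Proof.
move=> p_prime m_gt1 p_m p_n.
have m1: m = 1 %[mod p].
  by apply/eqP; rewrite eqn_mod_dvd ?subn1 // ltnW.
have p_sum: ~~ (p %| \sum_(i < n) m ^ i).
  by rewrite /dvdn (geometric_sum_mod n m1).
have sum_gt0: 0 < \sum_(i < n) m ^ i.
  by rewrite lt0n; apply: contraNneq p_sum => ->.
rewrite predn_exp lognM //; last by rewrite -subn1 subn_gt0.
by rewrite [logn p (\sum_(_ < _) _)]logn_coprime ?addn0 // prime_coprime.
Qed.

Lemma logn_predX_prime (p m : nat) :
  prime p -> odd p -> 1 < m -> p %| m.-1 ->
  logn p (m ^ p).-1 = (logn p m.-1).+1.
Proof.
move=> p_prime p_odd m_gt1 p_m.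
have m_gt0 := ltnW m_gt1; have p_gt1 := prime_gt1 p_prime.
have sum_p := geometric_sum_mod_sqr p_prime p_odd m_gt0 p_m.
have p2_sum: ~~ (p ^ 2 %| \sum_(i < p) m ^ i).
  by rewrite /dvdn sum_p -/(dvdn _ _) -{2}[p]expn1 dvdn_Pexp2l.
have p_sum: p %| \sum_(i < p) m ^ i.
  by rewrite /dvdn -(modn_dvdm _ (dvdn_mulr p (dvdnn p) : p %| p ^ 2)) sum_p
             modn_dvdm ?modnn // dvdn_mulr.
have sum_gt0: 0 < \sum_(i < p) m ^ i.
  by rewrite lt0n; apply: contraNneq p2_sum => ->; rewrite dvdn0.
rewrite predn_exp lognM //; last by rewrite -subn1 subn_gt0.
suff ->: logn p (\sum_(i < p) m ^ i) = 1 by rewrite addn1.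
apply/eqP; rewrite eqn_leq -ltnS ltnNge -!pfactor_dvdn //.
by rewrite p2_sum expn1.
Qed.

(** The [p]-part of the exponent is handled one factor [p] at a time, the
    congruence of the base to 1 being preserved by raising to the power [p]. *)
Lemma logn_predX (p m r k : nat) :
  prime p -> odd p -> 1 < m -> p %| m.-1 -> ~~ (p %| k) ->
  logn p (m ^ (p ^ r * k)).-1 = logn p m.-1 + r.
Proof.
move=> p_prime p_odd m_gt1 p_m p_k.
elim: r m m_gt1 p_m => [|r IHr] m m_gt1 p_m.
  by rewrite mul1n addn0 logn_predX_coprime.
have p_gt0 := prime_gt0 p_prime.
rewrite expnS -mulnA expnM IHr ?logn_predX_prime ?addSnnS //.
  by rewrite -(exp1n p) ltn_exp2r.
by rewrite predn_exp dvdn_mulr.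
Qed.

Lemma dvdn_mersenneE (p n : nat) :
  (p %| mersenne n) = (2 ^ n == 1 %[mod p]).
Proof. by rewrite /mersenne -eqn_mod_dvd ?expn_gt0. Qed.

Lemma dvdn_mersenne (p n : nat) (p_odd : odd p) :
  (p %| mersenne n) = (mersenne_order p_odd %| n).
Proof.
rewrite /mersenne_order; case: ex_minnP => v /andP[v_gt0 p_v] v_min.
have pow_v j: 2 ^ (j * v) = 1 %[mod p].
  rewrite mulnC expnM -modnXm.
  by move: p_v; rewrite dvdn_mersenneE => /eqP ->; rewrite modnXm exp1n.
have reduce: (p %| mersenne n) = (p %| mersenne (n %% v)).
  rewrite !dvdn_mersenneE {1}(divn_eq n v) expnD.
  by rewrite -modnMml pow_v modnMml mul1n.
rewrite reduce [v %| n]/dvdn; case: posnP => [->|rem_gt0].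
  by rewrite dvdn_mersenneE eqxx.
apply/negP=> p_rem; have := v_min (n %% v); rewrite rem_gt0 p_rem => /(_ isT).
by rewrite leqNgt ltn_pmod.
Qed.

Lemma mersenne_order_gt0 (p : nat) (p_odd : odd p) : 0 < mersenne_order p_odd.
Proof. by rewrite /mersenne_order; case: ex_minnP => v /andP[]. Qed.

(** Fermat's little theorem makes the order a divisor of [p - 1]. *)
Lemma mersenne_order_lt (p : nat) (p_odd : odd p) :
  prime p -> mersenne_order p_odd < p.
Proof.
move=> p_prime; have p_gt1 := prime_gt1 p_prime.
have: mersenne_order p_odd %| totient p.
  rewrite -dvdn_mersenne dvdn_mersenneE.
  by apply/eqP/Euler_exp_totient; rewrite coprime2n.
rewrite totient_prime // => /dvdn_leq; rewrite -subn1 subn_gt0 => /(_ p_gt1).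
by move=> /leq_ltn_trans; apply; rewrite subn1 ltn_predL ltnW.
Qed.

Theorem proposition1p3 (p n : nat) (p_odd : odd p) (p_prime : prime p)
    (n_gt0 : 0 < n) :
  (~~ (mersenne_order p_odd %| n) -> logn p (mersenne n) = 0) /\
  (forall r k : nat, 0 < k -> ~~ (p %| k) ->
     n = mersenne_order p_odd * p ^ r * k ->
     logn p n = r /\ logn p (mersenne n) = wieferich_exponent p_odd + r).
Proof.
have v_gt0 := mersenne_order_gt0 p_odd.
split=> [v_n | r k k_gt0 p_k ->].
  by apply: logn_coprime; rewrite prime_coprime // dvdn_mersenne.
split.
  have p_v: ~~ (p %| mersenne_order p_odd).
    by rewrite gtnNdvd ?mersenne_order_lt.
  have pr_gt0: 0 < p ^ r by rewrite expn_gt0 prime_gt0.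
  rewrite !lognM ?muln_gt0 ?v_gt0 //.
  by rewrite pfactorK // !logn_coprime ?prime_coprime // addn0.
rewrite /wieferich_exponent /mersenne -mulnA expnM !subn1 logn_predX //.
  by rewrite -(expn0 2) ltn_exp2l.
by rewrite -subn1 -/(mersenne _) dvdn_mersenne.
Qed.
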